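(* Constructive-Exists-Delete is solvable in $O(n^2)$ time.
   Context: A Stable Marriage (SM) instance consists of a set $U$ of men and a set $W$ of women with $|U|=|W|=n$, and for every agent a strict total order (preference list) over all agents of the opposite gender. A matching is a set of man–woman pairs in which each agent appears at most once; an agent in no pair is unassigned. A man–woman pair $\{m,w\}$ blocks a matching $M$ if ($m$ is unassigned or prefers $w$ to his partner in $M$) and ($w$ is unassigned or prefers $m$ to her partner in $M$); $M$ is stable if no pair blocks it (these definitions apply also when the numbers of men and women differ). Delete action: remove one agent from the instance (and from all preference lists); the numbers of deleted men and women need not be equal. Constructive-Exists-Delete: given an SM instance, a man–woman pair $\{m^*,w^*\}$ and a budget $\ell$, decide whether one can delete at most $\ell$ agents such that $\{m^*,w^*\}$ belongs to at least one stable matching of the resulting instance. *)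

(* Defs.v *)
From mathcomp Require Import all_boot.
Set Implicit Arguments. Unset Strict Implicit. Unset Printing Implicit Defensive.

(* Men and women are both indexed by 'I_n.  The preference list of man m   *)
(* is the n-tuple [pm m] of women (most preferred first); it must list     *)
(* every woman exactly once (uniq), i.e. it is a strict total order.       *)
(* Same for women with [pw].                                               *)

Definition valid_prefs (n : nat) (p : 'I_n -> n.-tuple 'I_n) : Prop :=
  forall a : 'I_n, uniq (p a).

Definition prefers (n : nat) (p : 'I_n -> n.-tuple 'I_n) (a x y : 'I_n) : bool :=
  index x (p a) < index y (p a).

(* After deleting agents, the remaining men form U and the remaining women
   form W; preference lists are restricted (relative order unchanged).
   A matching of the instance (U, W) is a set of pairs (m, w) with m in U,
   w in W, each agent in at most one pair. *)
Definition is_matching (n : nat) (U W : {set 'I_n}) (M : {set 'I_n * 'I_n}) : Prop :=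
  (forall e, e \in M -> (e.1 \in U) && (e.2 \in W)) /\
  (forall e f, e \in M -> f \in M -> e.1 = f.1 -> e = f) /\
  (forall e f, e \in M -> f \in M -> e.2 = f.2 -> e = f).

Definition blocks (n : nat) (pm pw : 'I_n -> n.-tuple 'I_n)
    (U W : {set 'I_n}) (M : {set 'I_n * 'I_n}) (m w : 'I_n) : Prop :=
  m \in U /\ w \in W /\
  ((forall w', (m, w') \notin M) \/
     (exists w', (m, w') \in M /\ prefers pm m w w')) /\
  ((forall m', (m', w) \notin M) \/
     (exists m', (m', w) \in M /\ prefers pw w m m')).

Definition stable (n : nat) (pm pw : 'I_n -> n.-tuple 'I_n)
    (U W : {set 'I_n}) (M : {set 'I_n * 'I_n}) : Prop :=
  is_matching U W M /\ forall m w, ~ blocks pm pw U W M m w.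

Definition CED_yes (n : nat) (pm pw : 'I_n -> n.-tuple 'I_n)
    (ms ws : 'I_n) (l : nat) : Prop :=
  exists (DU DW : {set 'I_n}),
    #|DU| + #|DW| <= l /\
    exists M : {set 'I_n * 'I_n},
      stable pm pw (~: DU) (~: DW) M /\ (ms, ws) \in M.

(* Computational model: unit-cost RAM (random access machine).             *)
(* Registers and memory cells hold natural numbers; each instruction costs *)
(* one step.                                                               *)

Inductive instr : Type :=
| IConst of nat & nat
| IAdd of nat & nat & nat
| ISub of nat & nat & nat
| ILoad of nat & nat
| IStore of nat & nat
| IJz of nat & nat
| IJmp of nat
| IHalt.

Record config : Type := Config {
  pc : nat;
  reg : nat -> nat;
  mem : nat -> nat
}.

Definition upd (f : nat -> nat) (i v : nat) : nat -> nat :=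
  fun j => if j == i then v else f j.

(* fetching outside the program yields IHalt *)
Definition fetch (P : seq instr) (i : nat) : instr := nth IHalt P i.

Definition halted (P : seq instr) (c : config) : bool :=
  if fetch P (pc c) is IHalt then true else false.

Definition step (P : seq instr) (c : config) : config :=
  let: Config p R Mm := c in
  match fetch P p with
  | IConst r k => Config p.+1 (upd R r k) Mm
  | IAdd r a b => Config p.+1 (upd R r (R a + R b)) Mm
  | ISub r a b => Config p.+1 (upd R r (R a - R b)) Mm
  | ILoad r a => Config p.+1 (upd R r (Mm (R a))) Mm
  | IStore a r => Config p.+1 R (upd Mm (R a) (R r))
  | IJz r t => Config (if R r == 0 then t else p.+1) R Mm
  | IJmp t => Config t R Mm
  | IHalt => c
  end.

Definition run (P : seq instr) (k : nat) (c : config) : config :=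
  iter k (step P) c.

(* Input encoding of an instance (n, pm, pw, ms, ws, l) in memory:
     Mem[0] = n, Mem[1] = ms, Mem[2] = ws, Mem[3] = l,
     Mem[4 + i*n + j]       = j-th entry of man i's list,
     Mem[4 + n*n + i*n + j] = j-th entry of woman i's list,
   (0 <= i, j < n), all other cells 0. Registers start at 0, pc at 0. *)
Definition encode (n : nat) (pm pw : 'I_n -> n.-tuple 'I_n)
    (ms ws : 'I_n) (l : nat) : nat -> nat :=
  fun a =>
    if a == 0 then n
    else if a == 1 then val ms
    else if a == 2 then val ws
    else if a == 3 then l
    else if a < 4 + n * n then
      let b := a - 4 in
      (match insub (b %/ n) with
       | Some i => match insub (b %% n) with
                   | Some j => val (tnth (pm i) j)
                   | None => 0 end
       | None => 0 end)
    else if a < 4 + 2 * (n * n) then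
      let b := a - 4 - n * n in
      (match insub (b %/ n) with
       | Some i => match insub (b %% n) with
                   | Some j => val (tnth (pw i) j)
                   | None => 0 end
       | None => 0 end)
    else 0.

Definition init_config (n : nat) (pm pw : 'I_n -> n.-tuple 'I_n)
    (ms ws : 'I_n) (l : nat) : config :=
  Config 0 (fun _ => 0) (encode pm pw ms ws l).

(* Main.v *)
Require Import Defs.
From mathcomp Require Import all_boot zify.
Set Implicit Arguments. Unset Strict Implicit. Unset Printing Implicit Defensive.

(* Call a woman a rival if m* prefers her to w*, and a man a rival if w*
   prefers him to m*.  For {m*, w*} to be stable, every remaining rival must be
   matched better than by m*, resp. w*.  So remove m* and w*, truncate the lists
   of the rivals accordingly and take any stable matching M of this instance:
   deleting the rivals that M leaves unmatched suffices.  This many deletions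
   are necessary: if M' is stable after deleting D, sending a man who prefers
   M' to M to the M-partner of his M'-partner shows that the number of men
   matched in M' but not in M is at most the number of deleted men matched in M,
   and likewise for women.

   M is computed by deferred acceptance, run on the full lists: m* is first
   tentatively held by w* and by all rival women, which makes them refuse
   whomever truncation forbids, and a rival man stops when he reaches w*.  The
   unmatched rivals are the women other than w* who keep m* and the men who
   stopped at w*, so the machine maintains their number as it goes. *)

(** * The optimum is read off any stable matching of the truncated instance *)

Section Exchange.

Variables (X Y : finType) (mr : X -> Y -> nat) (wr : Y -> X -> nat).
Hypothesis mr_inj : forall x, injective (mr x).
Hypothesis wr_inj : forall y, injective (wr y).

Definition injective_rel (M : X -> Y -> bool) :=
  (forall x y y', M x y -> M x y' -> y = y') /\
  (forall x x' y, M x y -> M x' y -> x = x').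

(** The positive form of not blocking. The inequalities are weak, so a pair of [M] is undominated by
    itself. *)
Definition undominated (M : X -> Y -> bool) x y :=
  (exists2 y', M x y' & mr x y' <= mr x y) \/
  (exists2 x', M x' y & wr y x' <= wr y x).

(** Let [P] collect the [x] strictly better off in [M']; those matched only in [M'] belong to it
    vacuously. The map [f] to the [M]-partner of the [M']-partner is injective on [P], and its
    values lie in [P] or in [D] and are matched in [M]. Cancelling the members of [P] that [M]
    matches leaves the claim. *)
Lemma card_gained_le_lost (acc M M' : X -> Y -> bool) (D : {set X}) (E : {set Y}) :
  injective_rel M -> injective_rel M' ->
  (forall x y, M x y -> acc x y) ->
  (forall x y, M' x y -> [/\ acc x y, x \notin D & y \notin E]) ->
  (forall x y, acc x y -> undominated M x y) ->
  (forall x y, acc x y -> x \notin D -> y \notin E -> undominated M' x y) ->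
  #|[set x | [exists y, M' x y] && ~~ [exists y, M x y]]|
    <= #|[set x in D | [exists y, M x y]]|.
Proof.
move=> [Mf Mi] [M'f M'i] Macc M'acc Mst M'st.
pose P := [set x | [exists y, M' x y && [forall y', M x y' ==> (mr x y < mr x y')]]].
pose Q := [set x | [exists y, M x y]].
pose f x := odflt x [pick x1 | [exists y, M' x y && M x1 y]].
have fP x : x \in P -> exists y, [/\ M' x y, M (f x) y & forall y', M x y' -> mr x y < mr x y'].
  rewrite inE => /existsP [y /andP [M'xy /forallP Hy]].
  have Hy' y' : M x y' -> mr x y < mr x y' by apply/implyP.
  have [axy xD yE] := M'acc _ _ M'xy.
  have [x1 Mx1] : exists x1, M x1 y.
    case: (Mst _ _ axy) => [[y' Mxy' le]|[x' Mx' _]]; last by exists x'.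
    by have := leq_trans (Hy' _ Mxy') le; rewrite ltnn.
  exists y; split=> //; rewrite /f; case: pickP => [x2 /existsP [y2 /andP [M'xy2 Mx2]] /=|/(_ x1)].
    by rewrite (M'f _ _ _ M'xy M'xy2).
  by case: existsP => // -[]; exists y; rewrite M'xy.
have finj : {in P &, injective f}.
  move=> x x' /fP [y [M'xy Mfy _]] /fP [y' [M'xy' Mfy' _]] e.
  rewrite e in Mfy; rewrite (Mf _ _ _ Mfy Mfy') in M'xy; exact: M'i M'xy M'xy'.
(* Stability of [M] makes [y] prefer [x1] to [x]. If [x1] is not deleted, stability of [M'] at
   [(x1, y)] then forces [x1] to be strictly better off in [M']. *)
have fsub : f @: P \subset (P :&: Q) :|: [set x in D | [exists y, M x y]].
  apply/subsetP => _ /imsetP [x xP ->].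
  have [y [M'xy Mfy Hy]] := fP _ xP; set x1 := f x in Mfy *.
  have x1Q : [exists y, M x1 y] by apply/existsP; exists y.
  rewrite !inE x1Q !andbT orbC; case: (boolP (x1 \in D)) => //= x1D.
  have [axy xD yE] := M'acc _ _ M'xy.
  have nx1 : x1 <> x by move=> e; rewrite e in Mfy; have := Hy _ Mfy; rewrite ltnn.
  have lt1 : wr y x1 <= wr y x.
    case: (Mst _ _ axy) => [[y' Mxy' le]|[x' Mx' le]]; last by rewrite (Mi _ _ _ Mfy Mx').
    by have := leq_trans (Hy _ Mxy') le; rewrite ltnn.
  case: (M'st _ _ (Macc _ _ Mfy) x1D yE) => [[y' M'x1 le]|[x' M'x' le]]; last first.
    rewrite (M'i _ _ _ M'x' M'xy) in le.
    by case: nx1; apply: (wr_inj (y := y)); apply/eqP; rewrite eqn_leq lt1.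
  apply/existsP; exists y'; rewrite M'x1; apply/forallP => y2; apply/implyP => M2.
  rewrite (Mf _ _ _ M2 Mfy) ltn_neqAle le andbT; apply/eqP => e.
  by rewrite (mr_inj e) in M'x1; apply: nx1; apply: M'i M'x1 M'xy.
have := subset_leq_card fsub; rewrite card_in_imset // => le1.
have le2 := leq_trans le1 (leq_card_setU _ _).
have e := cardsID Q P.
have : #|P :\: Q| <= #|[set x in D | [exists y, M x y]]| by move: le2 e; clear; lia.
apply: leq_trans; apply: subset_leq_card; apply/subsetP => x; rewrite !inE.
move=> /andP [/existsP [y M'xy] nM]; rewrite nM; apply/existsP; exists y; rewrite M'xy.
by apply/forallP => y'; apply/implyP => Mxy'; case/existsP: nM; exists y'.
Qed.

End Exchange.

(** * Preference lists as rank functions *)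

Section Prefs.

Variables (n : nat) (p : 'I_n -> n.-tuple 'I_n).
Hypothesis vp : valid_prefs p.

Lemma mem_prefs a x : x \in p a.
Proof.
have /eqP sz : #|p a| == #|'I_n| by rewrite (card_uniqP (vp a)) size_tuple card_ord.
have := @subset_cardP _ (mem (p a)) (mem 'I_n) sz.
by move=> /(_ (subset_predT _)) ->.
Qed.

Lemma index_prefs_inj a : injective (fun x => index x (p a)).
Proof. by move=> x y /(congr1 (nth x (p a))); rewrite !nth_index // mem_prefs. Qed.

Lemma index_prefs_lt a x : index x (p a) < n.
Proof. by have := mem_prefs a x; rewrite -index_mem size_tuple. Qed.

Lemma nth_prefsK a d j : j < n -> index (nth d (p a) j) (p a) = j.
Proof. by move=> h; rewrite index_uniq ?size_tuple ?vp. Qed.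

(** Used with [j] the rank of [ws] for [ms]: this rank is the number of rival women, hence the
    initial value of the counter. *)
Lemma card_index_prefs_lt a j : j <= n -> #|[set x | index x (p a) < j]| = j.
Proof.
move=> jn; have := card_uniqP (take_uniq j (vp a)).
rewrite size_take size_tuple => e; have {}e : #|take j (p a)| = j.
  by rewrite e; case: ltnP => //; move: jn; clear; lia.
by rewrite -[RHS]e; apply: eq_card => x; rewrite !inE in_take ?mem_prefs.
Qed.

End Prefs.

(** * From deletions to the truncated instance *)

Section Reduction.

Variables (n : nat) (pm pw : 'I_n -> n.-tuple 'I_n) (ms ws : 'I_n).
Hypotheses (vm : valid_prefs pm) (vw : valid_prefs pw).

Definition rivalW w := prefers pm ms w ws.
Definition rivalM m := prefers pw ws m ms.

(** The truncated instance is given by its acceptable pairs rather than by shorter lists, so that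
    ranks remain those of the full lists. *)
Definition acc m w :=
  [&& m != ms, w != ws, rivalW w ==> prefers pw w m ms & rivalM m ==> prefers pm m w ws].

Definition mrank (m w : 'I_n) : nat := index w (pm m).
Definition wrank (w m : 'I_n) : nat := index m (pw w).

Definition unmatchedM (M : 'I_n -> 'I_n -> bool) :=
  [set m | rivalM m && ~~ [exists w, M m w]].
Definition unmatchedW (M : 'I_n -> 'I_n -> bool) :=
  [set w | rivalW w && ~~ [exists m, M m w]].

Definition trunc_stable (M : 'I_n -> 'I_n -> bool) :=
  [/\ injective_rel M, forall m w, M m w -> acc m w &
      forall m w, acc m w -> undominated mrank wrank M m w].

Lemma mrank_inj m : injective (mrank m). Proof. exact: index_prefs_inj. Qed.
Lemma wrank_inj w : injective (wrank w). Proof. exact: index_prefs_inj. Qed.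

Lemma not_blocks_undominated U W (M : {set 'I_n * 'I_n}) m w :
  ~ blocks pm pw U W M m w -> m \in U -> w \in W ->
  undominated mrank wrank (fun m w => (m, w) \in M) m w.
Proof.
move=> nb mU wW.
case: (boolP [exists w', ((m, w') \in M) && (mrank m w' <= mrank m w)]) => [/existsP [w' /andP [h1 h2]]|n1].
  by left; exists w'.
case: (boolP [exists m', ((m', w) \in M) && (wrank w m' <= wrank w m)]) => [/existsP [m' /andP [h1 h2]]|n2].
  by right; exists m'.
case: nb; split=> //; split=> //; split.
- case: (pickP [pred w' | (m, w') \in M]) => [w' /= h|h]; last by left=> w'; exact: negbT (h w').
  right; exists w'; split=> //; rewrite /prefers ltnNge; apply: contra n1 => le.
  by apply/existsP; exists w'; rewrite h.
- case: (pickP [pred m' | (m', w) \in M]) => [m' /= h|h]; last by left=> m'; exact: negbT (h m').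
  right; exists m'; split=> //; rewrite /prefers ltnNge; apply: contra n2 => le.
  by apply/existsP; exists m'; rewrite h.
Qed.

(** The witness is [M] plus the pair [(ms, ws)]. A blocking partner of [ms] or [ws] would be a
    rival, who is matched better than that. Any other blocking pair is unacceptable, hence contains
    a rival for whom the other is no better than [ms], resp. [ws], while the partner in [M] is. *)
Lemma CED_yes_of_trunc_stable M l : trunc_stable M ->
  #|unmatchedM M| + #|unmatchedW M| <= l -> CED_yes pm pw ms ws l.
Proof.
move=> [[Mf Mi] Macc Mst] le; exists (unmatchedM M), (unmatchedW M); split=> //.
pose N := [set e : 'I_n * 'I_n | (e == (ms, ws)) || M e.1 e.2].
have NE m w : ((m, w) \in N) = ((m == ms) && (w == ws)) || M m w by rewrite inE.
have Nf m w w' : (m, w) \in N -> (m, w') \in N -> w = w'.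
  rewrite !NE => /orP [/andP [/eqP e1 /eqP ->]|h1] /orP [/andP [/eqP e2 /eqP ->]|h2] //.
  - by have := Macc _ _ h2; rewrite e1 /acc eqxx.
  - by have := Macc _ _ h1; rewrite e2 /acc eqxx.
  - exact: Mf h1 h2.
have Ni m m' w : (m, w) \in N -> (m', w) \in N -> m = m'.
  rewrite !NE => /orP [/andP [/eqP -> /eqP e1]|h1] /orP [/andP [/eqP -> /eqP e2]|h2] //.
  - by have := Macc _ _ h2; rewrite e1 /acc eqxx andbF.
  - by have := Macc _ _ h1; rewrite e2 /acc eqxx andbF.
  - exact: Mi h1 h2.
exists N; split; last by rewrite NE !eqxx.
split.
  split; last split; first last.
  - by move=> [m w] [m' w'] h h' /= e; rewrite -e in h' *; rewrite (Ni _ _ _ h h').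
  - by move=> [m w] [m' w'] h h' /= e; rewrite -e in h' *; rewrite (Nf _ _ _ h h').
  move=> [m w]; rewrite NE /= !inE => /orP [/andP [/eqP -> /eqP ->]|h].
    by rewrite /rivalM /rivalW /prefers !ltnn.
  by rewrite !negb_and !negbK; apply/andP; split; apply/orP; right; apply/existsP; [exists w|exists m].
(* a rival that was not deleted is matched in M, hence better than by m*, resp. w* *)
have matW w : w \in ~: unmatchedW M -> rivalW w -> exists2 m, (m, w) \in N & prefers pw w m ms.
  rewrite !inE => + rw; rewrite rw /= negbK => /existsP [m h]; exists m; first by rewrite NE h orbT.
  by have /and4P [_ _ /implyP + _] := Macc _ _ h; apply.
have matM m : m \in ~: unmatchedM M -> rivalM m -> exists2 w, (m, w) \in N & prefers pm m w ws.
  rewrite !inE => + rw; rewrite rw /= negbK => /existsP [w h]; exists w; first by rewrite NE h orbT.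
  by have /and4P [_ _ _ /implyP] := Macc _ _ h; apply.
have mNs : (ms, ws) \in N by rewrite NE !eqxx.
move=> m w [mU [wW [bm bw]]].
have bm' w' : (m, w') \in N -> prefers pm m w w'.
  by case: bm => [h1 h2|[w2 [h1 h3] h2]]; [case/negP: (h1 w')|rewrite (Nf _ _ _ h2 h1)].
have bw' m' : (m', w) \in N -> prefers pw w m m'.
  by case: bw => [h1 h2|[w2 [h1 h3] h2]]; [case/negP: (h1 m')|rewrite (Ni _ _ _ h2 h1)].
case: (eqVneq m ms) => [e|nms].
  subst m; have [m' h1 h2] := matW _ wW (bm' _ mNs).
  by have := bw' _ h1; move: h2; rewrite /prefers; clear; lia.
case: (eqVneq w ws) => [e|nws].
  subst w; have [m' h1 h2] := matM _ mU (bw' _ mNs).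
  by have := bm' _ h1; move: h2; rewrite /prefers; clear; lia.
case: (boolP (acc m w)) => [/Mst [[w' h1 h2]|[m' h1 h2]]|].
- have := bm' w'; rewrite NE h1 orbT => /(_ isT); move: h2; rewrite /prefers /mrank; clear; lia.
- have := bw' m'; rewrite NE h1 orbT => /(_ isT); move: h2; rewrite /prefers /wrank; clear; lia.
rewrite /acc nms nws /= negb_and !negb_imply => /orP [] /andP [rv np].
- have [m' h1 h2] := matW _ wW rv; have := bw' _ h1; move: h2 np; rewrite /prefers; clear; lia.
- have [w' h1 h2] := matM _ mU rv; have := bm' _ h1; move: h2 np; rewrite /prefers; clear; lia.
Qed.

Lemma injective_rel_swap (M : 'I_n -> 'I_n -> bool) :
  injective_rel M -> injective_rel (fun w m => M m w).
Proof. by move=> [h1 h2]; split=> x y y' H H'; [apply: h2 H H' | apply: h1 H H']. Qed.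

Lemma undominated_swap (M : 'I_n -> 'I_n -> bool) m w :
  undominated mrank wrank M m w -> undominated wrank mrank (fun w m => M m w) w m.
Proof. by case; [right|left]. Qed.

(** Removing [(ms, ws)] from the given matching [N] leaves a stable matching [M'] of the truncated
    instance without [D] and [E]. The exchange bound is then applied to each side in turn. *)
Lemma trunc_stable_of_CED_yes M l : trunc_stable M -> CED_yes pm pw ms ws l ->
  #|unmatchedM M| + #|unmatchedW M| <= l.
Proof.
move=> [Minj Macc Mst] [D [E [le [N [[[N1 [N2 N3]] nb] Ns]]]]]; apply: leq_trans le.
pose M' m w := ((m, w) \in N) && (m != ms).
have Nf m w w' : (m, w) \in N -> (m, w') \in N -> w = w' by move=> h h'; case: (N2 _ _ h h' erefl).
have Ni m m' w : (m, w) \in N -> (m', w) \in N -> m = m' by move=> h h'; case: (N3 _ _ h h' erefl).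
have NU m w : (m, w) \in N -> m \notin D /\ w \notin E by move=> /N1; rewrite !inE => /andP.
have [msD wsE] := NU _ _ Ns.
have und m w : m \notin D -> w \notin E -> undominated mrank wrank (fun m w => (m, w) \in N) m w.
  by move=> mD wE; apply: not_blocks_undominated (nb m w) _ _; rewrite inE.
have M'inj : injective_rel M'.
  by split=> x y y' /andP [h1 _] /andP [h2 _]; [apply: Nf h1 h2 | apply: Ni h1 h2].
have M'acc m w : M' m w -> [/\ acc m w, m \notin D & w \notin E].
  move=> /andP [h nms]; have [mD wE] := NU _ _ h; split=> //; apply/and4P.
  have nws : w != ws by apply: contra nms => /eqP e; rewrite e in h; rewrite (Ni _ _ _ h Ns).
  split=> //; apply/implyP; rewrite /rivalM /rivalW /prefers => rv.
  - case: (und _ _ msD wE) => [[w' h1 h2]|[m' h1 h2]].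
      by move: h2 rv; rewrite (Nf _ _ _ h1 Ns) /mrank; clear; lia.
    move: h2; rewrite (Ni _ _ _ h1 h) leq_eqVlt => /orP [/eqP /wrank_inj e|//].
    by rewrite e eqxx in nms.
  - case: (und _ _ mD wsE) => [[w' h1 h2]|[m' h1 h2]].
      move: h2; rewrite (Nf _ _ _ h1 h) leq_eqVlt => /orP [/eqP /mrank_inj e|//].
      by rewrite e eqxx in nws.
    by move: h2 rv; rewrite (Ni _ _ _ h1 Ns) /wrank; clear; lia.
have M'st m w : acc m w -> m \notin D -> w \notin E -> undominated mrank wrank M' m w.
  move=> /and4P [nms nws _ _] mD wE; case: (und _ _ mD wE) => [[w' h1 h2]|[m' h1 h2]].
    by left; exists w' => //; rewrite /M' h1.
  right; exists m' => //; rewrite /M' h1; apply: contra nws => /eqP e; rewrite e in h1.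
  by rewrite (Nf _ _ _ h1 Ns).
have cM := card_gained_le_lost mrank_inj wrank_inj Minj M'inj Macc M'acc Mst M'st.
have cW := @card_gained_le_lost _ _ _ _ wrank_inj mrank_inj (fun w m => acc m w) _ _ E D
  (injective_rel_swap Minj) (injective_rel_swap M'inj)
  (fun w m => @Macc m w) (fun w m h => let: And3 a b c := M'acc m w h in And3 a c b)
  (fun w m h => undominated_swap (Mst m w h))
  (fun w m a b c => undominated_swap (M'st m w a c b)).
(* An unmatched rival is either deleted, hence among the deleted agents free in [M], or matched in
   [M'] only, hence charged to the deleted agents matched in [M]. The two shares add up to [F]. *)
have halves (T : finType) (F : {set T}) (q : pred T) (R S : {set T}) :
    (forall x, x \in R -> x \notin F -> x \in S) -> (forall x, x \in R -> ~~ q x) ->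
    #|S| <= #|[set x in F | q x]| -> #|R| <= #|F|.
  move=> hS hq leS; rewrite -(cardsID F R) -(cardsID [set x | q x] F) addnC; apply: leq_add.
    apply: leq_trans (leq_trans leS _); apply: subset_leq_card; apply/subsetP => x.
      by rewrite inE => /andP [? ?]; apply: hS.
    by rewrite !inE.
  by apply: subset_leq_card; apply/subsetP => x; rewrite !inE => /andP [/hq -> ->].
(* A rival that is not deleted must be matched in [M'], otherwise it would block [N] together with
   [ws], resp. [ms]. *)
apply: leq_add; [apply: (halves _ _ _ _ _ _ _ cM)|apply: (halves _ _ _ _ _ _ _ cW)] => x;
  rewrite !inE => /andP [rv nM]; rewrite ?nM //= => xD; rewrite andbT; apply/existsP.
- case: (und _ _ xD wsE) => [[w' h1 h2]|[m' h1 h2]].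
    by exists w'; rewrite /M' h1 /=; apply: contraTneq rv => ->; rewrite /rivalM /prefers ltnn.
  by move: h2 rv; rewrite (Ni _ _ _ h1 Ns) /wrank /rivalM /prefers; clear; lia.
- case: (und _ _ msD xD) => [[w' h1 h2]|[m' h1 h2]].
    by move: h2 rv; rewrite (Nf _ _ _ h1 Ns) /mrank /rivalW /prefers; clear; lia.
  exists m'; rewrite /M' h1 /=; apply: contraTneq rv => e; rewrite e in h1.
  by rewrite (Nf _ _ _ h1 Ns) /rivalW /prefers ltnn.
Qed.

Lemma CED_yes_trunc_stable M l : trunc_stable M ->
  CED_yes pm pw ms ws l <-> #|unmatchedM M| + #|unmatchedW M| <= l.
Proof.
by move=> st; split; [exact: trunc_stable_of_CED_yes | exact: CED_yes_of_trunc_stable].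
Qed.

End Reduction.

(** * Deferred acceptance *)

Lemma upd_eq f a v : upd f a v a = v.
Proof. by rewrite /upd eqxx. Qed.

Lemma upd_neq f a v b : b != a -> upd f a v b = f b.
Proof. by rewrite /upd => /negbTE ->. Qed.

Section DeferredAcceptance.

Variables (n : nat) (pm pw : 'I_n -> n.-tuple 'I_n) (ms ws : 'I_n).
Hypotheses (vm : valid_prefs pm) (vw : valid_prefs pw).

Notation rivalM := (rivalM pw ms ws).
Notation rivalW := (rivalW pm ms ws).
Notation mrank := (mrank pm).
Notation wrank := (wrank pw).

(** A reversed rank: larger is better and every man scores at least 1, so 0 can encode a free woman
    and loses to any proposer. *)
Definition score (w m : 'I_n) := n - wrank w m.

Lemma mrank_lt m w : mrank m w < n. Proof. exact: index_prefs_lt. Qed.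
Lemma wrank_lt w m : wrank w m < n. Proof. exact: index_prefs_lt. Qed.

Lemma score_gt0 w m : 0 < score w m.
Proof. by rewrite subn_gt0 wrank_lt. Qed.

Lemma score_le w m m' : (score w m <= score w m') = (wrank w m' <= wrank w m).
Proof. by have := wrank_lt w m; have := wrank_lt w m'; clear; rewrite /score; lia. Qed.

Lemma score_inj w : injective (score w).
Proof.
move=> m m' e; apply: (wrank_inj vw (w := w)); apply/eqP.
by rewrite eqn_leq -!score_le e leqnn.
Qed.

(** As [nx m] counts proposals, the last woman asked has rank one less; here she is [ws]. *)
Definition stopped (nx : nat -> nat) (m : 'I_n) := rivalM m && ((mrank m ws).+1 == nx m).

(** Scores are injective, so [bs w] determines the man. The artificial engagements of [ms] are left
    out. *)
Definition held (bs : nat -> nat) (m w : 'I_n) := [&& m != ms, w != ws & bs w == score w m].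

(* [nx m]: number of women m has proposed to; [bs w]: score of the man she
   holds, 0 if none.  Initially m* is held by w* and by every rival woman at
   once, and a rival man proposing to w* stops there.  The men up to [i] have
   entered, [cur] is the one currently proposing, [cnt] counts the women still
   holding m* and the men stopped at w*. *)
Record DA_inv (i cur : nat) (nx bs : nat -> nat) (cnt : nat) : Prop := DAInv {
  DA_nx_le : forall m : 'I_n, nx m <= n;
  DA_nx_ms : nx ms = n;
  DA_nx_new : forall m : 'I_n, i < m -> m != ms -> nx m = 0;
  DA_cur_le : forall m : 'I_n, m = cur :> nat -> m != ms -> m <= i;
  DA_proposed : forall m w : 'I_n, m != ms -> w != ws -> mrank m w < nx m -> score w m <= bs w;
  DA_stop : forall m : 'I_n, rivalM m -> mrank m ws < nx m -> (mrank m ws).+1 = nx m;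
  DA_holder : forall w : 'I_n, 0 < bs w ->
    (exists2 m, held bs m w & (mrank m w).+1 = nx m)
    \/ bs w = score w ms /\ (w = ws \/ rivalW w);
  DA_rival : forall w : 'I_n, rivalW w -> score w ms <= bs w;
  DA_ws : bs ws = score ws ms;
  DA_settled : forall m : 'I_n, m <= i -> m != cur :> nat -> m != ms ->
    (exists w, held bs m w) \/ nx m = n \/ stopped nx m;
  DA_cur_free : forall m : 'I_n, m = cur :> nat -> (forall w, ~~ held bs m w) /\ ~~ stopped nx m;
  DA_cnt : cnt = #|[set w : 'I_n | (w != ws) && (bs w == score w ms)]|
               + #|[set m | stopped nx m]|
}.

Lemma ms_not_rival : rivalM ms = false.
Proof. by rewrite /rivalM /prefers ltnn. Qed.

Lemma ws_not_rival : rivalW ws = false.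
Proof. by rewrite /rivalW /prefers ltnn. Qed.

Lemma rivalM_neq m : rivalM m -> m != ms.
Proof. by apply: contraTneq => ->; rewrite ms_not_rival. Qed.

(** * The final state of deferred acceptance *)

Section Final.
Variables (cur cnt : nat) (nx bs : nat -> nat).
Hypothesis I : DA_inv n cur nx bs cnt.
Hypothesis cur_n : cur = n.

Lemma final_holder m w : held bs m w -> (mrank m w).+1 = nx m.
Proof.
move=> /and3P [nms nws /eqP e].
have : 0 < bs w by rewrite e score_gt0.
case/(DA_holder I) => [[m' /and3P [_ _ /eqP e'] h]|[e' _]].
  by rewrite e in e'; rewrite (score_inj e').
by rewrite e in e'; rewrite (score_inj e') eqxx in nms.
Qed.

Lemma final_settled m : m != ms -> (exists w, held bs m w) \/ nx m = n \/ stopped nx m.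
Proof.
move=> nms; apply: (DA_settled I) => //; first exact: ltnW (ltn_ord m).
by rewrite cur_n neq_ltn ltn_ord.
Qed.

Lemma final_stable : trunc_stable pm pw ms ws (held bs).
Proof.
split.
- split=> [m w w' h h'|m m' w /and3P [_ _ /eqP e] /and3P [_ _ /eqP e']].
    have := final_holder h'; rewrite -(final_holder h) => -[e].
    by apply: (mrank_inj vm (m := m)); rewrite e.
  by apply: (score_inj (w := w)); rewrite -e.
- move=> m w h; have := h => /and3P [nms nws /eqP e]; rewrite /acc nms nws /=.
  apply/andP; split; apply/implyP => rv.
    have := DA_rival I rv; rewrite e score_le leq_eqVlt => /orP [/eqP e'|//].
    by rewrite (wrank_inj vw e') eqxx in nms.
  rewrite /prefers ltnNge -/(mrank m w) -/(mrank m ws); apply/negP.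
  rewrite leq_eqVlt => /orP [/eqP e'|lt].
    by rewrite (mrank_inj vm e') eqxx in nws.
  have := DA_stop I rv; rewrite -(final_holder h) => /(_ (leqW lt)) [e'].
  by rewrite e' ltnn in lt.
- move=> m w /and4P [nms nws /implyP aw /implyP am].
  (* Either [m] is held by a woman he likes at least as well, or he has already asked [w]. In the
     latter case [w] holds someone at least as good, and not [ms], since [m] is acceptable to
     her. *)
  have [[w' h le]|lt] : (exists2 w', held bs m w' & mrank m w' <= mrank m w) \/ mrank m w < nx m.
  + case: (final_settled nms) => [[w' h]|[->|]]; last 2 first.
    * by right; apply: mrank_lt.
    * by case/andP => /am lt /eqP <-; right; apply: ltnW.
    rewrite -(final_holder h) ltnS.
    by case: (leqP (mrank m w') (mrank m w)) => [le|/ltnW lt]; [left; exists w'|right].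
  + by left; exists w'.
  right; have sc := DA_proposed I nms nws lt.
  have /(DA_holder I) : 0 < bs w by apply: leq_trans sc; apply: score_gt0.
  case=> [[m' h _]|[e [e'|/aw rv]]].
  + by exists m' => //; have /and3P [_ _ /eqP e] := h; rewrite -score_le -e.
  + by rewrite e' eqxx in nws.
  + by move: sc; rewrite e score_le leqNgt -/(prefers _ _ _ _) rv.
Qed.

Lemma final_count :
  cnt = #|unmatchedM pw ms ws (held bs)| + #|unmatchedW pm ms ws (held bs)|.
Proof.
rewrite (DA_cnt I) addnC; congr (_ + _); apply: eq_card => x; rewrite !inE.
- apply/idP/andP => [/andP [rv /eqP e]|[rv /existsP nh]].
    split=> //; apply/existsP => -[w h]; have := final_holder h.
    rewrite -e => -[/(mrank_inj vm) ew].
    by have /and3P [_] := h; rewrite ew eqxx.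
  (* A rival man who exhausted his list has asked [ws], and by [DA_stop] she was the last one. *)
  case: (final_settled (rivalM_neq rv)) => [//|[e|//]].
  by rewrite /stopped rv (DA_stop I rv) ?eqxx // e mrank_lt.
- apply/andP/andP => [[nws /eqP e]|[rv /existsP nh]].
    have /(DA_holder I) : 0 < bs x by rewrite e score_gt0.
    case=> [[m /and3P [nms _ /eqP e'] _]|[_ [e'|rv]]].
    + by rewrite e in e'; rewrite (score_inj e') eqxx in nms.
    + by rewrite e' eqxx in nws.
    split=> //; apply/existsP => -[m /and3P [nms _ /eqP e']].
    by rewrite e in e'; rewrite (score_inj e') eqxx in nms.
  have nws : x != ws by apply: contraTneq rv => ->; rewrite ws_not_rival.
  split=> //; have /(DA_holder I) : 0 < bs x by apply: leq_trans (DA_rival I rv); apply: score_gt0.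
  by case=> [[m h _]|[-> _]] //; case: nh; exists m.
Qed.

End Final.

Lemma DA_correct cnt nx bs l : DA_inv n n nx bs cnt ->
  CED_yes pm pw ms ws l <-> cnt <= l.
Proof.
by move=> I; rewrite (CED_yes_trunc_stable vm vw l (final_stable I erefl)) -(final_count I erefl).
Qed.

(** The value [n] of [cur] means that nobody is proposing. A held man has made a proposal, so a
    newcomer other than [ms] is held by nobody. When [i.+1] is [n], the result is the final
    state. *)
Lemma DA_enter i nx bs cnt : i < n -> DA_inv i n nx bs cnt -> DA_inv i.+1 i.+1 nx bs cnt.
Proof.
move=> lti [] nle nms nnew cle prop stp hold riv bws settled cfree count.
split=> //.
- by move=> m /ltnW; apply: nnew.
- by move=> m ->.
- move=> m le nc nm; apply: settled => //; last by rewrite neq_ltn ltn_ord.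
  by rewrite -ltnS ltn_neqAle nc.
- move=> m e; have nx0 : m != ms -> nx m = 0 by apply: nnew; rewrite e.
  split; last by apply/negP => /andP [/rivalM_neq /nx0 ->]; rewrite -[_ == _]/false.
  move=> w; apply/negP => /and3P [nm nws /eqP h].
  have /hold : 0 < bs w by rewrite h score_gt0.
  case=> [[m' /and3P [_ _ /eqP h'] e']|[h' _]].
    by rewrite h in h'; rewrite -(score_inj h') nx0 in e'.
  by rewrite h in h'; rewrite (score_inj h') eqxx in nm.
Qed.

(** * One proposal of the current man *)

Section Step.
Variables (i cnt : nat) (c : 'I_n) (nx bs : nat -> nat).
Hypothesis I : DA_inv i c nx bs cnt.

(** This also disposes of [ms]: his list counts as exhausted from the start, so he is dropped
    whenever he enters or is displaced. *)
Lemma DA_exhausted : nx c = n -> DA_inv i n nx bs cnt.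
Proof.
have [] := I => nle nms nnew cle prop stp hold riv bws settled cfree count e.
split=> //.
- by move=> m e'; have := ltn_ord m; rewrite e' ltnn.
- move=> m le _ nm; case: (eqVneq m c) => [->|nc]; [by auto|exact: settled].
- by move=> m e'; have := ltn_ord m; rewrite e' ltnn.
Qed.

Variable w : 'I_n.
Hypothesis w_next : mrank c w = nx c.

Let nx' := upd nx c (nx c).+1.

Lemma cur_neq_ms : c != ms.
Proof. by apply/eqP => e; have := mrank_lt c w; rewrite w_next e (DA_nx_ms I) ltnn. Qed.

Lemma nx'_neq (m : 'I_n) : m != c -> nx' m = nx m.
Proof. by move=> h; rewrite /nx' upd_neq. Qed.

Lemma nx'_cur : nx' c = (nx c).+1. Proof. by rewrite /nx' upd_eq. Qed.

Lemma cur_lt_stop : rivalM c -> nx c <= mrank c ws.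
Proof.
move=> rv; rewrite leqNgt; apply/negP => lt; have [_ /negP []] := DA_cur_free I erefl.
by rewrite /stopped rv (DA_stop I rv lt) eqxx.
Qed.

Lemma nx'_le (m : 'I_n) : nx' m <= n.
Proof.
case: (eqVneq m c) => [->|nc]; last by rewrite nx'_neq // (DA_nx_le I).
by rewrite nx'_cur -w_next mrank_lt.
Qed.

Lemma nx'_ms : nx' ms = n.
Proof. by rewrite nx'_neq ?(DA_nx_ms I) // eq_sym cur_neq_ms. Qed.

Lemma nx'_new (m : 'I_n) : i < m -> m != ms -> nx' m = 0.
Proof.
move=> lt nm; rewrite nx'_neq ?(DA_nx_new I) //; apply: contraTneq lt => ->.
by rewrite -leqNgt (DA_cur_le I) ?cur_neq_ms.
Qed.

Lemma nx'_stop (m : 'I_n) : rivalM m -> mrank m ws < nx' m -> (mrank m ws).+1 = nx' m.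
Proof.
case: (eqVneq m c) => [->|nc]; last by rewrite nx'_neq //; apply: (DA_stop I).
move=> rv; rewrite nx'_cur ltnS => le; congr _.+1; apply/eqP.
by rewrite eqn_leq le cur_lt_stop.
Qed.

Lemma nx'_proposed (bs' : nat -> nat) (m w' : 'I_n) :
  (forall w' : 'I_n, bs w' <= bs' w') -> score w c <= bs' w ->
  m != ms -> w' != ws -> mrank m w' < nx' m -> score w' m <= bs' w'.
Proof.
move=> mono le nm nw; case: (eqVneq m c) => [->|nc]; last first.
  by rewrite nx'_neq // => lt; apply: leq_trans (mono w'); apply: (DA_proposed I).
rewrite nx'_cur ltnS leq_eqVlt => /orP [/eqP|lt].
  by rewrite -w_next => /(mrank_inj vm) ->.
by apply: leq_trans (mono w'); apply: (DA_proposed I) => //; apply: cur_neq_ms.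
Qed.

Lemma nx'_stopped_neq (m : 'I_n) : m != c -> stopped nx' m = stopped nx m.
Proof. by move=> nc; rewrite /stopped nx'_neq. Qed.

Lemma nx'_stopped_cur : stopped nx' c = rivalM c && (w == ws).
Proof.
rewrite /stopped nx'_cur eqSS -w_next; case: rivalM => //=.
by apply/eqP/eqP => [/(mrank_inj vm)|->].
Qed.

Lemma stopped_cur : stopped nx c = false.
Proof. by apply/negbTE; case: (DA_cur_free I erefl). Qed.

Lemma card_stopped : #|[set m | stopped nx' m]| = (rivalM c && (w == ws)) + #|[set m | stopped nx m]|.
Proof.
rewrite -nx'_stopped_cur (cardsD1 c) inE; congr (_ + _).
rewrite [RHS](cardsD1 c) !inE stopped_cur; apply: eq_card => m; rewrite !inE.
by case: eqVneq => //= nc; rewrite nx'_stopped_neq.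
Qed.

Lemma nx'_holder (w' : 'I_n) : 0 < bs w' ->
  (exists2 m, held bs m w' & (mrank m w').+1 = nx' m) \/ bs w' = score w' ms /\ (w' = ws \/ rivalW w').
Proof.
case/(DA_holder I) => [[m h e]|]; last by right.
left; exists m => //; rewrite nx'_neq //; apply: contraTneq h => ->.
by case: (DA_cur_free I erefl) => + _; apply.
Qed.

(** Since [ws] holds [ms] throughout, the ordinary acceptance test at [ws] recognizes rivals. *)
Lemma ws_rival_score : (bs ws < score ws c) = rivalM c.
Proof. by rewrite (DA_ws I) ltnNge score_le -ltnNge. Qed.

Lemma DA_reject : score w c <= bs w -> DA_inv i c nx' bs cnt.
Proof.
move=> le; have nr : rivalM c && (w == ws) = false.
  apply/negP => /andP [rv /eqP e]; move: le.
  by rewrite e leqNgt ws_rival_score rv.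
have [] := I => nle nms nnew cle prop stp hold riv bws settled cfree count.
split=> //; [exact: nx'_le|exact: nx'_ms|exact: nx'_new| |exact: nx'_stop|exact: nx'_holder| | |].
- by move=> m w'; apply: nx'_proposed.
- move=> m lei nc nm; rewrite nx'_neq // nx'_stopped_neq //; exact: settled.
- move=> m /val_inj ->; split; first by case: (cfree c).
  by rewrite nx'_stopped_cur nr.
- by rewrite count card_stopped nr.
Qed.

Lemma DA_stopped : bs w < score w c -> w = ws -> DA_inv i n nx' bs cnt.+1.
Proof.
move=> lt e; have nr : rivalM c && (w == ws) by rewrite -ws_rival_score e eqxx andbT -e.
have [] := I => nle nms nnew cle prop stp hold riv bws settled cfree count.
split=> //; [exact: nx'_le|exact: nx'_ms|exact: nx'_new| | |exact: nx'_stop|exact: nx'_holder| | |].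
- by move=> m e'; have := ltn_ord m; rewrite e' ltnn.
- move=> m w' nm nw; case: (eqVneq m c) => [->|nc]; last by rewrite nx'_neq //; apply: prop.
  rewrite nx'_cur ltnS leq_eqVlt => /orP [/eqP|]; last by apply: prop => //; apply: cur_neq_ms.
  by rewrite -w_next e => /(mrank_inj vm) e'; rewrite e' eqxx in nw.
- move=> m lei _ nm; case: (eqVneq m c) => [->|nc].
    by right; right; rewrite nx'_stopped_cur.
  by rewrite nx'_neq // nx'_stopped_neq //; apply: settled.
- by move=> m e'; have := ltn_ord m; rewrite e' ltnn.
- by rewrite count card_stopped nr add1n addnS.
Qed.

Let bs' := upd bs w (score w c).

(** Here [d] is the displaced man, or [n] if [w] was free. A displaced man other than [ms] made his
    last proposal to [w], so he is neither held elsewhere nor stopped at [ws]. Displacing [ms] takes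
    [w] out of the count. *)
Lemma DA_accept (d : nat) :
  bs w < score w c -> w != ws ->
  (bs w = 0 /\ d = n) \/ (exists2 m : 'I_n, bs w = score w m & d = m) ->
  DA_inv i d nx' bs' (cnt - (d == ms)).
Proof.
move=> lt nws dP.
have [] := I => nle nms nnew cle prop stp hold riv bws settled cfree count.
have bs'E (x : 'I_n) : bs' x = if x == w then score w c else bs x by rewrite /bs' /upd.
have bs'w : bs' w = score w c by rewrite bs'E eqxx.
have bs'n (x : 'I_n) : x != w -> bs' x = bs x by rewrite bs'E => /negbTE ->.
have mono (x : 'I_n) : bs x <= bs' x by rewrite bs'E; case: eqP => [->|//]; apply: ltnW.
have cn := cur_neq_ms.
have nr : rivalM c && (w == ws) = false by rewrite (negbTE nws) andbF.
have dms (m : 'I_n) : m = d :> nat -> bs w = score w m.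
  case: dP => [[_ ->] e|[m' h ->] /val_inj -> //].
  by have := ltn_ord m; rewrite e ltnn.
have dpos (m : 'I_n) : m = d :> nat -> m != ms -> (mrank m w).+1 = nx m.
  move=> /dms e nm; have /hold : 0 < bs w by rewrite e score_gt0.
  case=> [[m' /and3P [_ _ /eqP h'] e']|[h' _]].
    by rewrite e in h'; rewrite (score_inj h').
  by rewrite e in h'; rewrite (score_inj h') eqxx in nm.
have dc (m : 'I_n) : m = d :> nat -> m != c.
  by move=> /dms e; apply: contraTneq lt => <-; rewrite e ltnn.
split=> //; [exact: nx'_le|exact: nx'_ms|exact: nx'_new| | |exact: nx'_stop| | | | | | ].
- move=> m md nm; rewrite leqNgt; apply/negP => lti.
  by have := nnew m lti nm; rewrite -(dpos m md nm).
- by move=> m w'; apply: nx'_proposed => //; rewrite bs'w.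
- move=> x; case: (eqVneq x w) => [->|nx_]; last first.
    rewrite bs'n // => /nx'_holder [[m h e]|h]; last by right.
    by left; exists m => //; move: h; rewrite /held bs'n.
  by left; exists c; [rewrite /held cn nws bs'w eqxx|rewrite nx'_cur w_next].
- by move=> x rv; apply: leq_trans (mono x); apply: riv.
- by rewrite bs'n // eq_sym.
- move=> m lei nd nm; case: (eqVneq m c) => [->|nc].
    by left; exists w; rewrite /held cn nws bs'w eqxx.
  rewrite nx'_neq // nx'_stopped_neq //; case: (settled m) => // [[x h]|]; last by right.
  left; exists x; move: h; rewrite /held nm /=; case: (eqVneq x w) => [->|nxw]; last by rewrite bs'n.
  case/andP => _ /eqP e; case: dP => [[e0 _]|[m' h em]].
    by have := score_gt0 w m; rewrite -e e0.
  by rewrite e in h; rewrite em (score_inj h) eqxx in nd.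
- move=> m md; split; last first.
    rewrite nx'_stopped_neq ?dc //; apply/negP => /andP [rv /eqP].
    by rewrite -(dpos m) ?rivalM_neq // => -[/(mrank_inj vm) e]; rewrite e eqxx in nws.
  move=> x; apply/negP => /and3P [nm nxs]; case: (eqVneq x w) => [->|nxw].
    by rewrite bs'w => /eqP /score_inj e; have := dc _ md; rewrite e eqxx.
  rewrite bs'n // => /eqP e; have /hold : 0 < bs x by rewrite e score_gt0.
  case=> [[m' /and3P [_ _ /eqP h'] e']|[h' _]].
    rewrite e in h'; rewrite -(score_inj h') -(dpos m) // in e'; case: e' => /(mrank_inj vm) e'.
    by rewrite e' eqxx in nxw.
  by rewrite e in h'; rewrite (score_inj h') eqxx in nm.
- rewrite card_stopped nr add0n count.
  have -> : #|[set x : 'I_n | (x != ws) && (bs x == score x ms)]| =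
     (d == ms) + #|[set x : 'I_n | (x != ws) && (bs' x == score x ms)]|; last by rewrite -addnA addKn.
  rewrite (cardsD1 w) !inE nws /=; congr (_ + _).
    congr nat_of_bool; apply/eqP/eqP => [e|/esym /dms //].
    case: dP => [[e0 _]|[m' h ->]]; first by have := score_gt0 w ms; rewrite -e e0.
    by rewrite e in h; rewrite (score_inj h).
  rewrite [RHS](cardsD1 w) !inE nws bs'w.
  have -> : (score w c == score w ms) = false.
    by apply: contraNF cn => /eqP /score_inj ->.
  apply: eq_card => x; rewrite !inE; case: eqVneq => //= nxw.
  by rewrite bs'n.
Qed.

End Step.

Lemma DA_init (nx bs : nat -> nat) cnt :
  (forall m : 'I_n, nx m = if m == ms then n else 0) ->
  (forall w : 'I_n, bs w = if (w == ws) || rivalW w then score w ms else 0) ->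
  cnt = mrank ms ws -> DA_inv 0 0 nx bs cnt.
Proof.
move=> nxE bsE ->.
have hE m w : held bs m w = false.
  apply/negP => /and3P [nm _]; rewrite bsE; case: ifP => _ /eqP e.
    by rewrite (score_inj e) eqxx in nm.
  by have := score_gt0 w m; rewrite -e.
have sE m : stopped nx m = false.
  by apply/negP => /andP [/rivalM_neq /negbTE nm]; rewrite nxE nm.
split.
- by move=> m; rewrite nxE; case: ifP.
- by rewrite nxE eqxx.
- by move=> m _ /negbTE nm; rewrite nxE nm.
- by move=> m ->.
- by move=> m w /negbTE nm; rewrite nxE nm.
- by move=> m /rivalM_neq /negbTE nm; rewrite nxE nm.
- by move=> w; rewrite bsE; case: ifP => // /orP [/eqP ->|rv] _; right; auto.
- by move=> w rv; rewrite bsE rv orbT.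
- by rewrite bsE eqxx.
- by move=> m; rewrite leqn0 => ->.
- by move=> m _; rewrite sE; split=> // w; rewrite hE.
- rewrite [X in _ + X]eq_card0 ?addn0; last by move=> m; rewrite inE sE.
  rewrite -[LHS](card_index_prefs_lt vm ms (ltnW (mrank_lt ms ws))).
  apply: eq_card => w; rewrite !inE -/(prefers _ _ _ _) -/(rivalW w) bsE.
  case: eqVneq => [->|nws] /=; first by rewrite ws_not_rival.
  case: rivalW; first by rewrite eqxx.
  by apply/esym/negbTE; rewrite eq_sym -lt0n score_gt0.
Qed.

End DeferredAcceptance.

(** * The random access machine *)

Definition reaches P t c (Q : config -> Prop) := exists2 k, k <= t & Q (run P k c).

Section Reaches.

Variable P : seq instr.

Lemma reaches_now t c (Q : config -> Prop) : Q c -> reaches P t c Q.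
Proof. by move=> h; exists 0. Qed.

Lemma reaches_step t c Q : reaches P t (step P c) Q -> reaches P t.+1 c Q.
Proof. by move=> [k le h]; exists k.+1; rewrite // /run iterSr. Qed.

Lemma reaches_trans t1 t2 c (Q1 Q2 : config -> Prop) :
  reaches P t1 c Q1 -> (forall c', Q1 c' -> reaches P t2 c' Q2) -> reaches P (t1 + t2) c Q2.
Proof.
move=> [k1 le1 h1] /(_ _ h1) [k2 le2 h2]; exists (k2 + k1); first by rewrite addnC leq_add.
by rewrite /run iterD.
Qed.

(** The variant [v] allows at most [v] repetitions; the successor pays for the pass that leaves the
    loop. *)
Lemma reaches_loop (Inv : nat -> config -> Prop) t Q :
  (forall v c, Inv v c -> reaches P t c (fun c' => Q c' \/ exists2 v', v' < v & Inv v' c')) ->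
  forall v c, Inv v c -> reaches P (t * v.+1) c Q.
Proof.
move=> body; elim/ltn_ind => v IH c /body [k le [h|[v' lt h]]].
  by exists k => //; apply: leq_trans le _; rewrite leq_pmulr.
have [k' le' h'] := IH _ lt _ h; exists (k' + k); last by rewrite /run iterD.
rewrite mulnS addnC leq_add //; apply: leq_trans le' _.
by rewrite leq_mul2l lt orbT.
Qed.

Lemma reaches_le t t' c Q : t <= t' -> reaches P t c Q -> reaches P t' c Q.
Proof. by move=> le [k lek h]; exists k => //; apply: leq_trans le. Qed.

Section Instructions.

Variables (t p : nat) (R M : nat -> nat) (Q : config -> Prop).

Lemma reaches_const r k : fetch P p = IConst r k ->
  reaches P t (Config p.+1 (upd R r k) M) Q -> reaches P t.+1 (Config p R M) Q.
Proof. by move=> e h; apply: reaches_step; rewrite /step e. Qed.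

(** Operand values enter through equations, so that symbolic execution records known terms instead
    of lookups in nested updates. *)
Lemma reaches_add r a b x y : fetch P p = IAdd r a b -> R a = x -> R b = y ->
  reaches P t (Config p.+1 (upd R r (x + y)) M) Q -> reaches P t.+1 (Config p R M) Q.
Proof. by move=> e <- <- h; apply: reaches_step; rewrite /step e. Qed.

Lemma reaches_sub r a b x y : fetch P p = ISub r a b -> R a = x -> R b = y ->
  reaches P t (Config p.+1 (upd R r (x - y)) M) Q -> reaches P t.+1 (Config p R M) Q.
Proof. by move=> e <- <- h; apply: reaches_step; rewrite /step e. Qed.

Lemma reaches_load r a x : fetch P p = ILoad r a -> R a = x ->
  reaches P t (Config p.+1 (upd R r (M x)) M) Q -> reaches P t.+1 (Config p R M) Q.
Proof. by move=> e <- h; apply: reaches_step; rewrite /step e. Qed.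

Lemma reaches_store r a x y : fetch P p = IStore a r -> R a = x -> R r = y ->
  reaches P t (Config p.+1 R (upd M x y)) Q -> reaches P t.+1 (Config p R M) Q.
Proof. by move=> e <- <- h; apply: reaches_step; rewrite /step e. Qed.

Lemma reaches_jz r q x : fetch P p = IJz r q -> R r = x ->
  (x = 0 -> reaches P t (Config q R M) Q) -> (0 < x -> reaches P t (Config p.+1 R M) Q) ->
  reaches P t.+1 (Config p R M) Q.
Proof.
move=> e <- h0 h1; apply: reaches_step; rewrite /step e.
by case: (posnP (R r)) => [|] h; [apply: h0|apply: h1].
Qed.

Lemma reaches_jmp q : fetch P p = IJmp q ->
  reaches P t (Config q R M) Q -> reaches P t.+1 (Config p R M) Q.
Proof. by move=> e h; apply: reaches_step; rewrite /step e. Qed.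

End Instructions.

End Reaches.

Lemma upd_look_neq f a v b x : (b == a) = false -> f b = x -> upd f a v b = x.
Proof. by rewrite /upd => ->. Qed.

Ltac look := lazymatch goal with
  | |- upd _ ?a _ ?a = _ => exact: upd_eq
  | |- upd _ _ _ _ = _ => apply: upd_look_neq; [reflexivity | look]
  | |- _ => eassumption || reflexivity
  end.

Ltac sstep := lazymatch goal with |- reaches ?P _ (Config ?p _ _) _ =>
  let ins := eval vm_compute in (fetch P p) in
  lazymatch ins with
  | IConst ?r ?k => apply: (@reaches_const P _ p _ _ _ r k); [reflexivity | ]
  | IAdd ?r ?a ?b => apply: (@reaches_add P _ p _ _ _ r a b); [reflexivity | look | look | ]
  | ISub ?r ?a ?b => apply: (@reaches_sub P _ p _ _ _ r a b); [reflexivity | look | look | ]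
  | ILoad ?r ?a => apply: (@reaches_load P _ p _ _ _ r a); [reflexivity | look | ]
  | IStore ?a ?r => apply: (@reaches_store P _ p _ _ _ r a); [reflexivity | look | look | ]
  | IJz ?r ?q => apply: (@reaches_jz P _ p _ _ _ r q); [reflexivity | look | | ]
  | IJmp ?q => apply: (@reaches_jmp P _ p _ _ _ q); [reflexivity | ]
  end end.

(* Registers: r0 = 0 (output), r1 = 1, r2 = n, r3 = m*, r4 = w*, r5 = n^2,
   r6 = 2n^2, r7, r8, r9 = base addresses [ROW], [NX], [BEST] below,
   r10 = cnt, r11 = i, r12 = cur, the others are scratch.  Jump targets are
   absolute; each block is preceded by its address. *)
Definition prog : seq instr := [::
  (* 0 *)
  IConst 1 1; ILoad 2 0; ILoad 3 1; IConst 13 2; ILoad 4 13;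
  IAdd 13 2 0;
  (* 6: n^2 by repeated addition *)
  IJz 13 10; IAdd 5 5 2; ISub 13 13 1; IJmp 6;
  (* 10 *)
  IAdd 6 5 5; IAdd 7 6 5; IConst 13 4; IAdd 7 7 13; IAdd 8 7 2; IAdd 9 8 2;
  (* 16: for each woman r11, her row start r13 = 4 + r11 * n goes to [ROW] *)
  ISub 14 2 11; IJz 14 33; IAdd 15 7 11; IStore 15 13;
  IAdd 16 13 5; IAdd 17 13 6; IAdd 18 2 0;
  (* 23: her list, inverted, becomes a row of scores n, n-1, ..., 1 *)
  IJz 18 30; ILoad 19 16; IAdd 19 17 19; IStore 19 18; IAdd 16 16 1; ISub 18 18 1; IJmp 23;
  (* 30 *)
  IAdd 13 13 2; IAdd 11 11 1; IJmp 16;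
  (* 33 *)
  IAdd 13 7 3; ILoad 13 13; IConst 11 0;
  (* 36: m* goes down his list until w*, and is held by everyone he meets *)
  ILoad 14 13; IAdd 15 7 14; ILoad 15 15; IAdd 15 15 6; IAdd 15 15 3; ILoad 15 15;
  IAdd 16 9 14; IStore 16 15;
  ISub 17 14 4; ISub 18 4 14; IAdd 17 17 18; IJz 17 51;
  IAdd 10 10 1; IAdd 13 13 1; IJmp 36;
  (* 51 *)
  IAdd 13 8 3; IStore 13 2;
  (* 53: main loop; r16 = woman proposed to, r18 = score of cur, r20 = score held *)
  ISub 13 2 11; IJz 13 95;
  IAdd 14 8 12; ILoad 15 14; ISub 13 2 15; IJz 13 92;
  IAdd 16 15 1; IStore 14 16;
  IAdd 16 7 12; ILoad 16 16; IAdd 16 16 15; ILoad 16 16;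
  IAdd 17 7 16; ILoad 17 17; IAdd 17 17 6; IAdd 18 17 12; ILoad 18 18;
  IAdd 19 9 16; ILoad 20 19; ISub 13 18 20; IJz 13 53;
  ISub 13 16 4; ISub 21 4 16; IAdd 13 13 21; IJz 13 91;
  IStore 19 18; IJz 20 92;
  (* 80: the displaced man proposes next; m* leaves the count *)
  ISub 17 17 5; IAdd 17 17 2; ISub 17 17 20; ILoad 12 17;
  ISub 13 12 3; ISub 21 3 12; IAdd 13 13 21; IJz 13 89; IJmp 53;
  (* 89 *)
  ISub 10 10 1; IJmp 53;
  (* 91: a rival man stops at w* *)
  IAdd 10 10 1;
  (* 92 *)
  IAdd 11 11 1; IAdd 12 11 0; IJmp 53;
  (* 95 *)
  IConst 13 3; ILoad 13 13; ISub 13 10 13; IJz 13 100; IHalt;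
  (* 100 *)
  IConst 0 1; IHalt ].

(** * Correctness and running time of the program *)

Section Program.

Variables (n : nat) (pm pw : 'I_n -> n.-tuple 'I_n) (ms ws : 'I_n) (l : nat).
Hypotheses (vm : valid_prefs pm) (vw : valid_prefs pw).

Notation mrank := (mrank pm).
Notation wrank := (wrank pw).
Notation score := (score pw).

(** Behind the input come the score table of [n * n] cells and three arrays of length [n]. The array
    of row starts replaces multiplication, which the machine does not have. *)
Definition ROW := n * n + n * n + n * n + 4.
Definition NX := ROW + n.
Definition BEST := NX + n.

Record static (R : nat -> nat) : Prop := Static {
  R0 : R 0 = 0; R1 : R 1 = 1; R2 : R 2 = n; R3 : R 3 = ms; R4 : R 4 = ws;
  R5 : R 5 = n * n; R6 : R 6 = n * n + n * n; R7 : R 7 = ROW; R8 : R 8 = NX; R9 : R 9 = BEST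
}.

Lemma static_upd R r v : 9 < r -> static R -> static (upd R r v).
Proof. by move=> lt []; split; rewrite upd_neq // neq_ltn (leq_trans _ lt). Qed.

(* Addresses are written as the program computes them, hence the
   uncancelled n * n in [layout_pw]; n - score w m is the rank of m. *)
Record layout (M nx bs : nat -> nat) : Prop := Layout {
  layout_l : M 3 = l;
  layout_pm : forall m w : 'I_n, M (4 + m * n + mrank m w) = w;
  layout_pw : forall w m : 'I_n,
    M (4 + w * n + (n * n + n * n) - n * n + n - score w m) = m;
  layout_score : forall w m : 'I_n, M (4 + w * n + (n * n + n * n) + m) = score w m;
  layout_row : forall a : 'I_n, M (ROW + a) = 4 + a * n;
  layout_nx : forall m : 'I_n, M (NX + m) = nx m;
  layout_best : forall w : 'I_n, M (BEST + w) = bs w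
}.

Lemma cell_lt (a : 'I_n) x : x < n -> a * n + x < n * n.
Proof. have := ltn_ord a; clear; nia. Qed.

Lemma layout_upd M nx bs a v (nx' bs' : nat -> nat) : NX <= a -> layout M nx bs ->
  (forall m : 'I_n, upd M a v (NX + m) = nx' m) ->
  (forall w : 'I_n, upd M a v (BEST + w) = bs' w) ->
  layout (upd M a v) nx' bs'.
Proof.
move=> le [hl hpm hpw hsc hrow hnx hbs] hnx' hbs'.
have old b : b < NX -> upd M a v b = M b by move=> h; rewrite upd_neq // neq_ltn (leq_trans h le).
split=> //.
- by rewrite old // /NX /ROW; clear; lia.
- move=> m w; rewrite old //; have := cell_lt m (mrank_lt vm m w).
  by rewrite /NX /ROW; clear; lia.
- move=> w m; rewrite old //; have := cell_lt w (wrank_lt vw w m).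
  by have := ltn_ord w; have := score_gt0 vw w m; rewrite /NX /ROW; clear; nia.
- move=> w m; rewrite old //; have := cell_lt w (ltn_ord m).
  by rewrite /NX /ROW; clear; lia.
- move=> b; rewrite old //; have := ltn_ord b.
  by rewrite /NX /ROW; clear; lia.
Qed.

Lemma layout_upd_nx M nx bs (m : 'I_n) v :
  layout M nx bs -> layout (upd M (NX + m) v) (upd nx m v) bs.
Proof.
move=> L; apply: layout_upd (L) _ _; first exact: leq_addr.
- by move=> m'; rewrite /upd eqn_add2l (layout_nx L).
- move=> w; rewrite upd_neq ?(layout_best L) //; have := ltn_ord m.
  by rewrite /BEST; clear; lia.
Qed.

Lemma layout_upd_best M nx bs (w : 'I_n) v :
  layout M nx bs -> layout (upd M (BEST + w) v) nx (upd bs w v).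
Proof.
move=> L; apply: layout_upd (L) _ _; first by rewrite /BEST -addnA leq_addr.
- move=> m; rewrite upd_neq ?(layout_nx L) //; have := ltn_ord m.
  by rewrite /BEST; clear; lia.
- by move=> m'; rewrite /upd eqn_add2l (layout_best L).
Qed.

(** The potential of the main loop: each pass that continues makes a proposal, lets the next man
    enter, or both. *)
Definition work_left (i : nat) (nx : nat -> nat) := (n - i) + \sum_(m < n) (n - nx m).

Lemma work_left_propose i (nx : nat -> nat) (c : 'I_n) : nx c < n ->
  work_left i (upd nx c (nx c).+1) < work_left i nx.
Proof.
move=> lt; rewrite /work_left ltn_add2l (bigD1 c) //= [X in _ < X](bigD1 c) //= upd_eq.
rewrite (eq_bigr (fun m : 'I_n => n - nx m)) ?ltn_add2r; first by lia.
by move=> m nc; rewrite upd_neq.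
Qed.

Definition main_inv (v : nat) (s : config) : Prop :=
  exists R M i cur nx bs cnt,
    [/\ s = Config 53 R M, static R, layout M nx bs,
        [/\ R 10 = cnt, R 11 = i & R 12 = cur] &
        [/\ DA_inv pm pw ms ws i cur nx bs cnt, i <= n, i < n -> cur < n, i = n -> cur = n &
            v = work_left i nx]].

Definition main_end (s : config) : Prop :=
  exists R M nx bs cnt,
    [/\ s = Config 95 R M, static R, layout M nx bs, R 10 = cnt &
        DA_inv pm pw ms ws n n nx bs cnt].

Ltac stat := repeat (apply: static_upd; [done | ]); assumption.

(** Apart from the exit, the branches of the code match [DA_exhausted], [DA_reject], [DA_stopped]
    and [DA_accept]; 60 is a generous bound on the length of a pass. *)
Lemma main_body v s : main_inv v s ->
  reaches prog 60 s (fun s' => main_end s' \/ exists2 v', v' < v & main_inv v' s').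
Proof.
move=> [R [M [i [cur [nx [bs [cnt [-> SR L [e10 e11 e12] [I le lt eqn ->]]]]]]]]].
have [e0 e1 e2 e3 e4 e5 e6 e7 e8 e9] := SR.
(* Branches after which some man [d] goes on proposing; those that let the next man enter are
   handled by [next]. *)
have back R' M' (d : 'I_n) nx' bs' cnt' : static R' -> layout M' nx' bs' ->
    R' 10 = cnt' -> R' 11 = i -> R' 12 = d -> i < n -> DA_inv pm pw ms ws i d nx' bs' cnt' ->
    work_left i nx' < work_left i nx ->
    reaches prog 0 (Config 53 R' M')
      (fun s' => main_end s' \/ exists2 v', v' < work_left i nx & main_inv v' s').
  move=> SR' L' h10 h11 h12 lti I' dec; apply: reaches_now; right; exists (work_left i nx') => //.
  exists R', M', i, d, nx', bs', cnt'; split=> //; split=> //.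
  by move=> ei; move: lti; rewrite ei ltnn.
have next R' M' nx' bs' cnt' : static R' -> layout M' nx' bs' ->
    R' 10 = cnt' -> R' 11 = i -> i < n -> DA_inv pm pw ms ws i n nx' bs' cnt' ->
    work_left i nx' <= work_left i nx ->
    reaches prog 3 (Config 92 R' M')
      (fun s' => main_end s' \/ exists2 v', v' < work_left i nx & main_inv v' s').
  move=> SR' L' h10 h11 lti I' dec; have [h0 h1 h2 h3 h4 h5 h6 h7 h8 h9] := SR'.
  sstep. sstep. sstep. rewrite addn0 addn1.
  apply: reaches_now; right; exists (work_left i.+1 nx').
    by move: dec lti; rewrite /work_left; clear; lia.
  eexists _, M', i.+1, i.+1, nx', bs', cnt'; split; [reflexivity | stat | exact L' | split; look | ].
  by split=> //; apply: DA_enter.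
sstep. sstep.
  move=> e; have ei : i = n by move: e le; clear; lia.
  apply: reaches_now; left; eexists _, M, nx, bs, cnt.
  by split; [reflexivity | stat | exact L | look | move: I; rewrite (eqn ei) ei].
rewrite subn_gt0 => lti; have [c ec] : exists c : 'I_n, cur = c by exists (Ordinal (lt lti)).
rewrite ec in e12 I; clear lt eqn ec cur.
sstep. sstep. rewrite (layout_nx L). sstep. sstep.
  move/eqP; rewrite subn_eq0 => le'.
  apply: reaches_le (next _ _ _ _ _ _ L _ _ lti _ (leqnn _)); [done|stat|look|look|].
  by apply: (DA_exhausted I); apply/eqP; rewrite eqn_leq le' (DA_nx_le I).
rewrite subn_gt0 => ltx.
have [w we] : exists w, mrank c w = nx c by exists (nth c (pm c) (nx c)); apply: nth_prefsK.
have dec := work_left_propose i ltx.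
sstep. sstep. rewrite addn1.
have := layout_upd_nx c (nx c).+1 L; move: (upd M _ _) => M1 {}L.
sstep. sstep. rewrite (layout_row L). sstep. sstep.
have -> : M1 (4 + c * n + nx c) = w by rewrite -we (layout_pm L).
sstep. sstep. rewrite (layout_row L). sstep. sstep. sstep. rewrite (layout_score L).
sstep. sstep. rewrite (layout_best L). sstep. sstep.
  move/eqP; rewrite subn_eq0 => le'.
  apply: reaches_le (back _ _ _ _ _ _ _ L _ _ _ lti _ dec); [done|stat|look|look|look|].
  exact: (DA_reject vm vw I we).
rewrite subn_gt0 => lts.
(* Equality of [w] and [ws] is tested by adding the two truncated differences. *)
sstep. sstep. sstep. sstep.
  move=> ew; have {}ew : w = ws by apply: val_inj => /=; move: ew; clear; lia.
  sstep.
  apply: reaches_le (next _ _ _ _ _ _ L _ _ lti _ (ltnW dec)); [done|stat|look|look|rewrite addn1].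
  exact: (DA_stopped vm vw I we).
move=> nw; have {}nw : w != ws by apply: contraTneq nw => ->; rewrite subnn.
sstep.
have := layout_upd_best w (score w c) L; move: (upd M1 _ _) => M2 {}L.
sstep.
  move=> eb.
  apply: reaches_le (next _ _ _ _ _ _ L _ _ lti _ (ltnW dec)); [done|stat|look|look|].
  have := DA_accept vm vw I we lts nw (or_introl (conj eb erefl)).
  by rewrite gtn_eqF ?subn0.
move=> pb.
have [m em] : exists m, bs w = score w m.
  by case: (DA_holder I pb) => [[m /and3P [_ _ /eqP h] _]|[h _]]; [exists m|exists ms].
have Ia := DA_accept vm vw I we lts nw (or_intror (ex_intro2 _ _ m em erefl)).
(* The displaced man is recovered from his score, which locates him in the list of [w]. *)
sstep. sstep. sstep. sstep. rewrite em (layout_pw L).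
sstep. sstep. sstep. sstep.
  move=> ed; have {}ed : (m == ms :> nat) by rewrite eqn_leq; move: ed; clear; lia.
  sstep. sstep. rewrite ed in Ia.
  apply: reaches_le (back _ _ _ _ _ _ _ L _ _ _ lti Ia dec); [done|stat|look..].
move=> nd; have {}nd : (m == ms :> nat) = false.
  by apply: contraTF nd => /eqP ->; rewrite subnn.
sstep. rewrite nd subn0 in Ia.
apply: reaches_le (back _ _ _ _ _ _ _ L _ _ _ lti Ia dec); [done|stat|look..].
Qed.

(** * Building the tables from the input *)

Notation enc := (encode pm pw ms ws l).

Lemma encode_list (p : 'I_n -> n.-tuple 'I_n) (a : 'I_n) j d : j < n ->
  match insub ((a * n + j) %/ n) with
  | Some i => match insub ((a * n + j) %% n) with
              | Some k => val (tnth (p i) k)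
              | None => 0 end
  | None => 0 end = nth d (p a) j :> nat.
Proof.
move=> lt; have n0 : 0 < n by apply: leq_ltn_trans lt.
rewrite divnMDl // divn_small // addn0 modnMDl modn_small // valK (insubT (fun k => k < n) lt) /=.
by rewrite (tnth_nth d).
Qed.

Lemma encode_pm (m : 'I_n) j d : j < n -> enc (4 + m * n + j) = nth d (pm m) j.
Proof.
move=> lt; have lc := cell_lt m lt.
have ne k : k < 4 -> (4 + m * n + j == k) = false by clear; lia.
rewrite /encode !ne // -addnA ltn_add2l lc addKn; exact: encode_list.
Qed.

Lemma encode_pw (w : 'I_n) j d : j < n -> enc (4 + w * n + n * n + j) = nth d (pw w) j.
Proof.
move=> lt; have lc := cell_lt w lt.
have ne k : k < 4 -> (4 + w * n + n * n + j == k) = false by clear; lia.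
rewrite /encode !ne //.
have -> : 4 + w * n + n * n + j = 4 + (n * n + (w * n + j)) by clear; lia.
rewrite !(ltn_add2l 4) !addKn mul2n -addnn ltn_add2l lc ltnNge leq_addr /=.
exact: encode_list.
Qed.

Lemma encode_out a : 4 + 2 * (n * n) <= a -> enc a = 0.
Proof.
move=> le; have ne k : k < 4 -> (a == k) = false by move: le; clear; lia.
rewrite /encode !ne // !ifN //; rewrite -leqNgt //.
by apply: leq_trans le; rewrite leq_add2l leq_pmull.
Qed.

(* State of the tables when the row starts of a < r are stored and the score
   lists of the women w < k are complete, that of k up to position j. *)
Record tables (k r j : nat) (M : nat -> nat) : Prop := Tables {
  tables_lo : forall a, a < 4 + (n * n + n * n) -> M a = enc a;
  tables_hi : forall a, NX <= a -> M a = 0;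
  tables_row : forall a : 'I_n, a < r -> M (ROW + a) = 4 + a * n;
  tables_score : forall w m : 'I_n, (w < k) || ((w == k :> nat) && (wrank w m < j)) ->
    M (4 + w * n + (n * n + n * n) + m) = score w m
}.

Lemma tables_init : tables 0 0 0 enc.
Proof.
split=> //; last by move=> w m; rewrite ltn0 andbF.
by move=> a le; apply: encode_out; move: le; rewrite /NX /ROW; clear; lia.
Qed.

Lemma tables_upd_row (k : 'I_n) M : tables k k 0 M -> tables k k.+1 0 (upd M (ROW + k) (4 + k * n)).
Proof.
have lk := ltn_ord k.
case=> lo hi row sc; split.
- move=> a le; rewrite upd_neq ?lo //; move: le; rewrite /ROW; clear; lia.
- move=> a le; rewrite upd_neq ?hi //; move: lk le; rewrite /NX; clear; lia.
- move=> a le; rewrite /upd eqn_add2l; case: eqVneq => [->//|ne]; apply: row.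
  by move: le ne; clear; lia.
- move=> w m h; rewrite upd_neq ?sc //; have := cell_lt w (ltn_ord m).
  by rewrite /ROW; clear; lia.
Qed.

Lemma tables_upd_score (k m : 'I_n) j M : wrank k m = j -> tables k k.+1 j M ->
  tables k k.+1 j.+1 (upd M (4 + k * n + (n * n + n * n) + m) (n - j)).
Proof.
move=> e; have lk := cell_lt k (ltn_ord m).
case=> lo hi row sc; split.
- move=> a le; rewrite upd_neq ?lo //; move: le; clear; lia.
- move=> a le; rewrite upd_neq ?hi //; move: lk le; rewrite /NX /ROW; clear; lia.
- move=> a le; rewrite upd_neq ?row //; move: lk; rewrite /ROW; clear; lia.
- move=> w m'; rewrite /upd !(addnAC _ (n * n + n * n)) eqn_add2r -!addnA eqn_add2l.
  have n0 : 0 < n by apply: leq_ltn_trans (ltn_ord m).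
  (* Division by [n] shows that a cell of the score table determines its woman and its man. *)
  case: (w * n + m' =P k * n + m) => [ee|ne] h.
    have ew : w = k.
      by apply: val_inj => /=; have /= := congr1 (divn^~ n) ee; rewrite !divnMDl // !divn_small // !addn0.
    move: ee; rewrite ew => /eqP; rewrite eqn_add2l => /eqP /val_inj ->.
    by rewrite /score e.
  have -> : 4 + (w * n + (m' + (n * n + n * n))) = 4 + w * n + (n * n + n * n) + m' by clear; lia.
  rewrite sc //; case/orP: h => [->//|/andP [/eqP /val_inj ew]].
  rewrite ew ltnS leq_eqVlt => /orP [/eqP em|->]; last by rewrite eqxx orbT.
  by case: ne; rewrite ew; rewrite -e in em; rewrite (wrank_inj vw em).
Qed.

Lemma tables_next (k : 'I_n) M : tables k k.+1 n M -> tables k.+1 k.+1 0 M.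
Proof.
case=> lo hi row sc; split=> // w m; rewrite andbF orbF ltnS leq_eqVlt orbC => h; apply: sc.
by rewrite (wrank_lt vw) andbT.
Qed.

Lemma layout_tables M : 0 < n -> tables n n 0 M -> layout M (fun _ => 0) (fun _ => 0).
Proof.
move=> n0 [lo hi row sc]; split.
- by rewrite lo.
- move=> m w; have lt := cell_lt m (mrank_lt vm m w).
  rewrite lo ?(encode_pm _ w (mrank_lt vm m w)) ?nth_index ?mem_prefs //.
  by move: lt; clear; lia.
- move=> w m; have lt := cell_lt w (wrank_lt vw w m).
  have -> : 4 + w * n + (n * n + n * n) - n * n + n - score w m = 4 + w * n + n * n + wrank w m.
    by have := wrank_lt vw w m; rewrite /score; clear; lia.
  rewrite lo ?(encode_pw _ m (wrank_lt vw w m)) ?nth_index ?mem_prefs //.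
  by move: lt; clear; lia.
- by move=> w m; apply: sc; rewrite ltn_ord.
- by move=> a; apply: row.
- by move=> m; apply: hi; apply: leq_addr.
- by move=> w; apply: hi; rewrite /BEST -addnA leq_addr.
Qed.

(** The counter and the current man, which must still be 0 when deferred acceptance is set up. *)
Definition idle (R : nat -> nat) := R 10 = 0 /\ R 12 = 0.

Lemma idle_upd R r v : 12 < r -> idle R -> idle (upd R r v).
Proof. by move=> lt [h1 h2]; split; rewrite upd_neq // neq_ltn (leq_trans _ lt). Qed.

Ltac idl := repeat (apply: idle_upd; [done | ]); assumption.

Definition square_inv (v : nat) (s : config) : Prop :=
  exists2 R, s = Config 6 R enc &
    [/\ [/\ R 0 = 0, R 1 = 1, R 2 = n, R 3 = ms & R 4 = ws],
        idle R /\ R 11 = 0, R 13 = v, v <= n & R 5 = (n - v) * n].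

Definition table_inv (v : nat) (s : config) : Prop :=
  exists R M k,
    [/\ s = Config 16 R M, static R, idle R,
        [/\ R 11 = k, R 13 = 4 + k * n, k <= n & v = n - k] & tables k k 0 M].

Definition row_inv (k : 'I_n) (v : nat) (s : config) : Prop :=
  exists R M j,
    [/\ s = Config 23 R M, static R, idle R,
        [/\ R 11 = k, R 13 = 4 + k * n, R 16 = 4 + k * n + n * n + j,
            R 17 = 4 + k * n + (n * n + n * n) & R 18 = n - j] &
        [/\ j <= n, v = n - j & tables k k.+1 j M]].

Definition row_end (k : 'I_n) (s : config) : Prop :=
  exists R M,
    [/\ s = Config 30 R M, static R, idle R, R 11 = k /\ R 13 = 4 + k * n & tables k k.+1 n M].

Definition table_end (s : config) : Prop :=
  exists R M, [/\ s = Config 33 R M, static R, idle R & tables n n 0 M].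

Lemma square_body v s : square_inv v s ->
  reaches prog 10 s (fun s' => table_inv n s' \/ exists2 v', v' < v & square_inv v' s').
Proof.
move=> [R -> [[e0 e1 e2 e3 e4] [id e11] e13 le e5]].
sstep => [v0|v1].
  have e5' : R 5 = n * n by rewrite e5 v0 subn0.
  sstep. sstep. sstep. sstep. sstep. sstep.
  apply: reaches_now; left; eexists _, enc, 0; split; [reflexivity| | idl | | exact: tables_init].
    split; look.
  by split; [look | look | | rewrite subn0].
sstep. sstep. sstep.
apply: reaches_now; right; exists v.-1; first by move: v1; clear; lia.
eexists; [reflexivity | split; [split; look | split; [idl | look] | | | ]].
- by rewrite upd_eq subn1.
- by move: le; clear; lia.
- rewrite upd_neq // upd_eq -mulSnr; congr (_ * _).
  by move: v1 le; clear; lia.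
Qed.

Lemma row_body k v s : row_inv k v s ->
  reaches prog 7 s (fun s' => row_end k s' \/ exists2 v', v' < v & row_inv k v' s').
Proof.
move=> [R [M [j [-> SR id [e11 e13 e16 e17 e18] [le -> T]]]]].
have [e0 e1 e2 e3 e4 e5 e6 e7 e8 e9] := SR.
sstep => [v0|].
  apply: reaches_now; left; exists R, M; split=> //.
  by have ej : j = n by [move: v0 le; clear; lia]; rewrite ej in T.
rewrite subn_gt0 => ltj.
have [m em] : exists m, wrank k m = j by exists (nth k (pw k) j); apply: nth_prefsK.
sstep.
have -> : M (4 + k * n + n * n + j) = m.
  rewrite (tables_lo T); last by have := cell_lt k ltj; clear; lia.
  by rewrite (encode_pw _ m ltj) -em nth_index // mem_prefs.
sstep. sstep. sstep. sstep. sstep.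
apply: reaches_now; right; exists (n - j.+1); first by move: ltj; clear; lia.
eexists _, _, j.+1; split; [reflexivity | stat | idl | | split=> //; exact: tables_upd_score].
by split; [look | look | rewrite upd_neq // upd_eq addn1 addnS | look | rewrite upd_eq -subnDA addn1].
Qed.

Lemma table_body v s : table_inv v s ->
  reaches prog (7 + 7 * n.+1 + 3) s (fun s' => table_end s' \/ exists2 v', v' < v & table_inv v' s').
Proof.
move=> [R [M [k [-> SR id [e11 e13 le ->] T]]]].
have [e0 e1 e2 e3 e4 e5 e6 e7 e8 e9] := SR.
rewrite -addnA; sstep. sstep => [v0|].
  apply: reaches_now; left; eexists _, _; split; [reflexivity | stat | idl | ].
  by have ek : k = n by [move: v0 le; clear; lia]; rewrite ek in T.
rewrite subn_gt0 => ltk; have [a ea] : exists a : 'I_n, k = a by exists (Ordinal ltk).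
rewrite ea in e11 e13 T le ltk *; clear k ea.
sstep. sstep. sstep. sstep. sstep. rewrite addn0.
apply: reaches_trans (_ : reaches _ _ _ (row_end a)) _.
  apply: (reaches_loop (@row_body a)); eexists _, _, 0.
  split; [reflexivity | stat | idl | | split; [done | by rewrite subn0 | exact: tables_upd_row]].
  by split; [look | look | rewrite upd_neq // upd_neq // upd_eq addn0 | look | rewrite upd_eq subn0].
move=> _ [R' [M' [-> SR' id' [h11 h13] T']]].
have [h0 h1 h2 h3 h4 h5 h6 h7 h8 h9] := SR'.
sstep. sstep. sstep.
apply: reaches_now; right; exists (n - a.+1); first by move: ltk; clear; lia.
eexists _, _, a.+1; split; [reflexivity | stat | | | exact: tables_next].
  by case: id' => i1 i2; split; look.
by split=> //; [rewrite upd_eq addn1 | rewrite upd_neq // upd_eq mulSn addnCA addnC].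
Qed.

Definition engage_inv (v : nat) (s : config) : Prop :=
  exists R M bs j,
    [/\ s = Config 36 R M, static R, layout M (fun _ => 0) bs,
        [/\ R 10 = j, R 11 = 0, R 12 = 0 & R 13 = 4 + ms * n + j] &
        [/\ j <= mrank ms ws, v = n - j &
            forall w : 'I_n, bs w = if mrank ms w < j then score w ms else 0]].

Lemma engage_body v s : engage_inv v s ->
  reaches prog 17 s (fun s' => main_inv (work_left 0 (upd (fun _ => 0) ms n)) s'
    \/ exists2 v', v' < v & engage_inv v' s').
Proof.
move=> [R [M [bs [j [-> SR L [e10 e11 e12 e13] [le -> bsE]]]]]].
have [e0 e1 e2 e3 e4 e5 e6 e7 e8 e9] := SR.
have ltj : j < n by apply: leq_ltn_trans le (mrank_lt vm _ _).
have [w we] : exists w, mrank ms w = j by exists (nth ms (pm ms) j); apply: nth_prefsK.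
sstep.
have -> : M (4 + ms * n + j) = w by rewrite -we (layout_pm L).
sstep. sstep. rewrite (layout_row L). sstep. sstep. sstep. rewrite (layout_score L).
sstep. sstep.
have := layout_upd_best w (score w ms) L; move: (upd M _ _) => M1 {}L.
have bsE' (x : 'I_n) : upd bs w (score w ms) x = if mrank ms x < j.+1 then score x ms else 0.
  rewrite /upd bsE ltnS [in RHS]leq_eqVlt -we.
  case: ((x : nat) =P w) => [/val_inj ->|ne]; first by rewrite eqxx.
  by case: (mrank ms x =P mrank ms w) => [/(mrank_inj vm) e|//]; case: ne; rewrite e.
sstep. sstep. sstep. sstep.
  move=> ew; have {}ew : w = ws by apply: val_inj => /=; move: ew; clear; lia.
  sstep. sstep.
  have := layout_upd_nx ms n L; move: (upd M1 _ _) => M2 {}L.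
  apply: reaches_now; left; eexists _, M2, 0, 0, _, _, j.
  split; [reflexivity | stat | exact: L | split; look | ].
  split=> //.
  (* The women met up to this point are exactly [ws] and the rivals. *)
  apply: (DA_init vm vw) => //; first by move=> w'; rewrite bsE' -we ew ltnS leq_eqVlt (inj_eq (mrank_inj vm (m := ms))).
  by rewrite -we ew.
move=> nw; have {}nw : w != ws by apply: contraTneq nw => ->; rewrite subnn.
sstep. sstep. sstep.
apply: reaches_now; right; exists (n - j.+1); first by move: ltj; clear; lia.
eexists _, M1, _, j.+1; split; [reflexivity | stat | exact: L | | split; [ | done | exact: bsE']].
  by split; [rewrite upd_neq // upd_eq addn1 | look | look | rewrite upd_eq addn1 addnS].
by rewrite ltn_neqAle le andbT; apply: contra nw => /eqP e; apply/eqP/(mrank_inj vm (m := ms)); rewrite we.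
Qed.

Definition accepts (s : config) : Prop := halted prog s /\ (reg s 0 = 1 <-> CED_yes pm pw ms ws l).

Lemma main_end_accepts s : main_end s -> reaches prog 5 s accepts.
Proof.
move=> [R [M [nx [bs [cnt [-> SR L e10 I]]]]]].
have [e0 e1 e2 e3 e4 e5 e6 e7 e8 e9] := SR.
have yes := DA_correct vm vw l I.
sstep. sstep. rewrite (layout_l L). sstep. sstep.
  move/eqP; rewrite subn_eq0 => /yes h; sstep; apply: reaches_now; split=> //.
rewrite subn_gt0 => lt; apply: reaches_now; split=> //=.
rewrite upd_neq // upd_neq // upd_neq // e0; split=> // /yes.
by rewrite leqNgt lt.
Qed.

(** The summands follow the program: set-up, squaring [n], tables, engagements of [ms], main loop,
    output. Only the tables and the main loop are quadratic. *)
Definition total_time := 5 + (1 + (10 * n.+1 + ((7 + 7 * n.+1 + 3) * n.+1 +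
  (3 + (17 * n.+1 + (60 * (n + n * n).+1 + 5)))))).

Lemma prog_correct : reaches prog total_time (init_config pm pw ms ws l) accepts.
Proof.
have n0 : 0 < n by apply: leq_ltn_trans (ltn_ord ms).
rewrite /total_time /init_config; sstep. sstep. sstep. sstep. sstep.
rewrite add1n. sstep.
apply: (reaches_trans (reaches_loop square_body (v := n) _)) => [|s1 /(reaches_loop table_body) r1].
  eexists; first reflexivity.
  split; [split; look | split; [split; look | look] | | done | by rewrite subnn].
  by rewrite upd_eq addn0.
apply: (reaches_trans r1) => _ [R [M [-> SR id T]]].
have [e0 e1 e2 e3 e4 e5 e6 e7 e8 e9] := SR.
have L := layout_tables n0 T.
sstep. sstep. rewrite (layout_row L). sstep.
apply: (reaches_trans (reaches_loop engage_body (v := n) _)) => [|s2 /(reaches_loop main_body) r2].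
  case: id => i10 i12.
  eexists _, M, _, 0; split; [reflexivity | stat | exact: L | | ].
    by split; [look | look | look | rewrite upd_neq // upd_eq addn0].
  by split=> //; rewrite subn0.
apply: (reaches_trans (reaches_le _ r2)) main_end_accepts.
rewrite leq_mul2l /= ltnS /work_left subn0 leq_add2l.
have -> : n * n = \sum_(m < n) n by rewrite sum_nat_const card_ord.
by apply: leq_sum => m _; apply: leq_subr.
Qed.

Lemma total_time_le : total_time <= 500 * n ^ 2.
Proof.
have n0 : 0 < n by apply: leq_ltn_trans (ltn_ord ms).
(* As [n] is positive, the linear and constant terms are absorbed into the square. *)
have : n <= n * n by rewrite leq_pmulr.
by rewrite /total_time -mulnn; move: n0; clear; nia.
Qed.

End Program.

(* There is a RAM program P and a constant c such that on every instance
   (of size n) P halts within c * n^2 steps (n >= 1 since ms exists) with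
   output R[0] = 1 exactly on yes-instances of Constructive-Exists-Delete. *)
Theorem mainTheorem8 :
  exists (P : seq instr) (c : nat),
    forall (n : nat) (pm pw : 'I_n -> n.-tuple 'I_n) (ms ws : 'I_n) (l : nat),
      valid_prefs pm -> valid_prefs pw ->
      exists k : nat,
        k <= c * n ^ 2 /\
        halted P (run P k (init_config pm pw ms ws l)) /\
        (reg (run P k (init_config pm pw ms ws l)) 0 = 1
           <-> CED_yes pm pw ms ws l).
Proof.
exists prog, 500 => n pm pw ms ws l vm vw.
have [k le acc] := prog_correct ms ws l vm vw.
by exists k; split=> //; apply: leq_trans le (total_time_le ms).
Qed.
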